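(* Let $\omega$ be a non-constant infinite sequence with entries in $\{0,1,2\}$ and suppose that the Grigorchuk group $G_\omega$ is a branch group. Then $G_\omega$ has the congruence subgroup property and $G_\omega$ is just infinite.
   Context: **Tree.** Let $\mathcal T$ be the binary rooted tree, whose vertices are identified with the finite words over $X=\{0,1\}$: the root is the empty word, and each word $\nu$ is joined to $\nu0$ and $\nu1$. Automorphisms of $\mathcal T$ fix the root and act on the right. The $n$th level consists of the words of length $n$. The natural isomorphism $\psi:\mathrm{St}_{\mathrm{Aut}(\mathcal T)}(1)\to \mathrm{Aut}(\mathcal T)\times\mathrm{Aut}(\mathcal T)$ sends an automorphism fixing level $1$ pointwise to its pair of restrictions to the subtrees rooted at the vertices $0$ and $1$ (each subtree identified with $\mathcal T$ by deleting the first letter). **Stabilisers.** For $G\le\mathrm{Aut}(\mathcal T)$, $\mathrm{St}_G(n)$ is the subgroup of elements of $G$ fixing every vertex at level $n$. For a vertex $u$, $\mathrm{Rist}_G(u)$ is the subgroup of elements of $G$ fixing every vertex of $\mathcal T$ that does not succeed $u$ (i.e. that does not have $u$ as a prefix), and $\mathrm{Rist}_G(n)$ is the direct product of the subgroups $\mathrm{Rist}_G(u)$ over all vertices $u$ at level $n$. **Grigorchuk groups.** For an infinite sequence $\omega=(\omega_1,\omega_2,\dots)$ in $\{0,1,2\}$, put $\sigma\omega=(\omega_2,\omega_3,\dots)$. Let $a$ be the automorphism swapping the two maximal subtrees (i.e. changing the first letter of each nonempty word and nothing else), and let $e$ be the identity. Define $b_\omega,c_\omega,d_\omega\in\mathrm{St}_{\mathrm{Aut}(\mathcal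 T)}(1)$ recursively by $\psi(b_\omega)=(\beta,b_{\sigma\omega})$, $\psi(c_\omega)=(\gamma,c_{\sigma\omega})$, $\psi(d_\omega)=(\delta,d_{\sigma\omega})$, where $\beta=e$ if $\omega_1=2$ and $\beta=a$ otherwise; $\gamma=e$ if $\omega_1=1$ and $\gamma=a$ otherwise; $\delta=e$ if $\omega_1=0$ and $\delta=a$ otherwise. The Grigorchuk group is $G_\omega=\langle a,b_\omega,c_\omega,d_\omega\rangle$. **Properties.** A group $G\le\mathrm{Aut}(\mathcal T)$ acting transitively on every level of $\mathcal T$ is a branch group if $\mathrm{Rist}_G(n)$ has finite index in $G$ for every $n\in\mathbb N$. It is known (Grigorchuk) that $G_\omega$ is branch if and only if $\omega$ is not eventually constant. A group $G\le\mathrm{Aut}(\mathcal T)$ has the congruence subgroup property if every finite-index subgroup of $G$ contains $\mathrm{St}_G(n)$ for some $n\in\mathbb N$. A group is just infinite if it is infinite and all its proper quotients are finite. *)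

(* Defs.v *)
From HB Require Import structures.
From mathcomp Require Import all_boot.
From mathcomp Require Import boolp classical_sets cardinality.

Set Implicit Arguments.
Unset Strict Implicit.
Unset Printing Implicit Defensive.

Local Open Scope classical_set_scope.
Local Open Scope group_scope.

(* Subgroups of a (possibly infinite) group are sets of elements. *)
Section Groups.
Variable gT : groupType.
Implicit Types G H N S : set gT.

Definition is_subgroup H :=
  [/\ H 1, forall x y, H x -> H y -> H (x * y) & forall x, H x -> H x^-1].

Definition generated S : set gT := smallest is_subgroup S.

Definition right_coset H (x : gT) : set gT := [set h * x | h in H].

Definition cosets G H : set (set gT) := [set right_coset H x | x in G].

Definition finite_index G H := finite_set (cosets G H).

Definition is_normal G N :=
  [/\ is_subgroup N, N `<=` G & forall x g, N x -> G g -> N (x ^ g)].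

(* [cosets G N] is the underlying set of the quotient [G / N], which is a
   proper quotient when [N] is nontrivial. *)
Definition just_infinite G :=
  infinite_set G /\
  forall N, is_normal G N -> N <> [set 1] -> finite_set (cosets G N).

Lemma generated_subgroup S : is_subgroup (generated S).
Proof.
split=> [H [[H1 _ _] _] // | x y Hx Hy H HS | x Hx H HS].
- by have [[_ HM _] _] := HS; apply: HM; [apply: Hx | apply: Hy].
- by have [[_ _ HV] _] := HS; apply: HV; apply: Hx.
Qed.

Lemma sub_generated S : S `<=` generated S.
Proof. exact: sub_smallest. Qed.

End Groups.

(* A word over {0,1}; the letter 0 is [false] and the letter 1 is [true]. *)
Definition word := seq bool.

Definition adj (u v : word) : bool :=
  [exists x : bool, (v == rcons u x) || (u == rcons v x)].

Record treeAut := TreeAut {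
  aut_fun :> word -> word;
  aut_inv : word -> word;
  aut_funK : cancel aut_fun aut_inv;
  aut_invK : cancel aut_inv aut_fun;
  aut_root : aut_fun [::] = [::];
  aut_adj : {mono aut_fun : u v / adj u v} }.

Lemma treeAutP (f g : treeAut) : f =1 g -> f = g.
Proof.
case: f g => [f f' fK f'K f0 fA] [g g' gK g'K g0 gA] /= fg.
have {fg} efg : f = g by apply: funext.
subst g.
have efg' : f' = g' by apply: funext => v; rewrite -{1}[v]g'K fK.
by subst g'; congr TreeAut; apply: Prop_irrelevance.
Qed.

HB.instance Definition _ := gen_eqMixin treeAut.
HB.instance Definition _ := gen_choiceMixin treeAut.

Section TreeAutGroup.
Implicit Types f g : treeAut.

Definition aut_one : treeAut :=
  @TreeAut id id (fun=> erefl) (fun=> erefl) erefl (fun _ _ => erefl).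

Fact aut_mul_root f g : (g \o f) [::] = [::].
Proof. by rewrite /= !aut_root. Qed.

Fact aut_mul_adj f g : {mono (g \o f) : u v / adj u v}.
Proof. by move=> u v /=; rewrite !aut_adj. Qed.

(* Automorphisms act on the right: [f * g] applies [f] first. *)
Definition aut_mul f g : treeAut :=
  TreeAut (can_comp (@aut_funK g) (@aut_funK f))
          (can_comp (@aut_invK f) (@aut_invK g))
          (aut_mul_root f g) (@aut_mul_adj f g).

Fact aut_inv_root f : aut_inv f [::] = [::].
Proof. by rewrite -{1}(aut_root f) aut_funK. Qed.

Fact aut_inv_adj f : {mono (aut_inv f) : u v / adj u v}.
Proof. by move=> u v; rewrite -(aut_adj f) !aut_invK. Qed.

Definition aut_invg f : treeAut :=
  TreeAut (@aut_invK f) (@aut_funK f) (aut_inv_root f) (@aut_inv_adj f).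

Fact aut_mulA : associative aut_mul.
Proof. by move=> f g h; apply: treeAutP. Qed.

Fact aut_mul1g : left_id aut_one aut_mul.
Proof. by move=> f; apply: treeAutP. Qed.

Fact aut_mulg1 : right_id aut_one aut_mul.
Proof. by move=> f; apply: treeAutP. Qed.

Fact aut_mulVg : left_inverse aut_one aut_invg aut_mul.
Proof. by move=> f; apply: treeAutP => v /=; rewrite aut_invK. Qed.

Fact aut_mulgV : right_inverse aut_one aut_invg aut_mul.
Proof. by move=> f; apply: treeAutP => v /=; rewrite aut_funK. Qed.

End TreeAutGroup.

HB.instance Definition _ := isGroup.Build treeAut
  aut_mulA aut_mul1g aut_mulg1 aut_mulVg aut_mulgV.

Section SubgroupsOfAut.
Implicit Type G : set treeAut.

Definition level_stab G (n : nat) : set treeAut :=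
  [set g | G g /\ forall v : word, size v = n -> g v = v].

Definition rist G (u : word) : set treeAut :=
  [set g | G g /\ forall v : word, ~~ prefix u v -> g v = v].

(* Internal direct product: the rigid stabilisers of distinct vertices of the
   same level commute, so the order of the factors is irrelevant. *)
Definition level_rist G (n : nat) : set treeAut :=
  [set \prod_(u : n.-tuple bool) g u |
     g in [set g : n.-tuple bool -> treeAut | forall u : n.-tuple bool, rist G u (g u)]].

Definition level_transitive G :=
  forall (n : nat) (u v : word), size u = n -> size v = n ->
    exists2 g : treeAut, G g & g u = v.

Definition branch G :=
  level_transitive G /\ forall n, finite_index G (level_rist G n).

Definition congruence_subgroup_property G :=
  forall H : set treeAut, is_subgroup H -> H `<=` G -> finite_index G H ->
    exists n, level_stab G n `<=` H.

End SubgroupsOfAut.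

(* [psi_eq g g0 g1]: [g] fixes level 1 pointwise and [psi g = (g0, g1)]. *)
Definition psi_eq (g g0 g1 : treeAut) :=
  forall v : word, g (false :: v) = false :: g0 v /\
                   g (true :: v) = true :: g1 v.

Lemma adj_cons (x y : bool) (u v : word) :
  adj (x :: u) (y :: v) = (x == y) && adj u v.
Proof.
apply/existsP/andP => [[z] | [/eqP-> /existsP[z zP]]].
- rewrite !rcons_cons !eqseq_cons [y == x]eq_sym -andb_orr => /andP[-> uvz].
  by split=> //; apply/existsP; exists z.
- by exists z; rewrite !rcons_cons !eqseq_cons eqxx.
Qed.

Lemma adj_sym : symmetric adj.
Proof. by move=> u v; apply: eq_existsb => x; rewrite orbC. Qed.

Lemma adj_nil (x : bool) (v : word) : adj [::] (x :: v) = (v == [::]).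
Proof.
apply/existsP/eqP => [[z] | ->]; last by exists x; rewrite eqxx.
by rewrite /= eqseq_cons orbF => /andP[_ /eqP].
Qed.

Definition swap_fun (v : word) : word :=
  if v is x :: v' then ~~ x :: v' else [::].

Fact swap_funK : involutive swap_fun.
Proof. by case=> //= x v; rewrite negbK. Qed.

Fact swap_fun_adj : {mono swap_fun : u v / adj u v}.
Proof.
move=> [|x u] [|y v] //=; rewrite ?[adj _ [::]]adj_sym ?adj_nil //.
by rewrite !adj_cons (inj_eq negb_inj).
Qed.

Definition gen_a : treeAut := TreeAut swap_funK swap_funK erefl swap_fun_adj.

(* [omega i] is the entry of index [i + 1] of the sequence. *)
Definition shift (omega : nat -> 'I_3) : nat -> 'I_3 := fun i => omega i.+1.

(* The common pattern of b, c and d: the section at the vertex 0 is trivial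
   when the first entry of the sequence is [k] and is [a] otherwise. *)
Fixpoint dir_fun (k : nat) (omega : nat -> 'I_3) (v : word) : word :=
  match v with
  | [::] => [::]
  | false :: v' =>
      false :: (if omega 0 == k :> nat then v' else swap_fun v')
  | true :: v' => true :: dir_fun k (shift omega) v'
  end.

Fact dir_funK k omega : involutive (dir_fun k omega).
Proof.
move=> v; elim: v omega => [|[] v IHv] omega //=; first by rewrite IHv.
by case: ifP => ->; rewrite ?swap_funK.
Qed.

Fact dir_fun_adj k omega : {mono (dir_fun k omega) : u v / adj u v}.
Proof.
have nilE om v : (dir_fun k om v == [::]) = (v == [::]) by case: v => [|[] v].
have snilE v : (swap_fun v == [::]) = (v == [::]) by case: v.
move=> u v; elim: u v omega => [|x u IHu] [|y v] omega //.
- case: y => /=; rewrite !adj_nil ?nilE //.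
  by case: ifP => // _; rewrite snilE.
- rewrite !(adj_sym _ [::]); case: x => /=; rewrite !adj_nil ?nilE //.
  by case: ifP => // _; rewrite snilE.
- case: x y => [] [] /=; rewrite !adj_cons ?IHu //=.
  by case: ifP => // _; rewrite swap_fun_adj.
Qed.

Definition gen_dir k omega : treeAut :=
  TreeAut (@dir_funK k omega) (@dir_funK k omega) erefl (@dir_fun_adj k omega).

Definition gen_b := gen_dir 2.
Definition gen_c := gen_dir 1.
Definition gen_d := gen_dir 0.

Lemma psi_b omega :
  psi_eq (gen_b omega) (if omega 0 == 2 :> nat then 1 else gen_a)
         (gen_b (shift omega)).
Proof. by move=> v; split=> //=; case: ifP. Qed.

Lemma psi_c omega :
  psi_eq (gen_c omega) (if omega 0 == 1%N :> nat then 1 else gen_a)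
         (gen_c (shift omega)).
Proof. by move=> v; split=> //=; case: ifP. Qed.

Lemma psi_d omega :
  psi_eq (gen_d omega) (if omega 0 == 0 :> nat then 1 else gen_a)
         (gen_d (shift omega)).
Proof. by move=> v; split=> //=; case: ifP. Qed.

Definition Grigorchuk_group (omega : nat -> 'I_3) : set treeAut :=
  generated [set gen_a; gen_b omega; gen_c omega; gen_d omega].

(* Main.v *)
Require Import Defs.
From mathcomp Require Import all_boot.
From mathcomp Require Import boolp classical_sets cardinality.

Set Implicit Arguments.
Unset Strict Implicit.
Unset Printing Implicit Defensive.

Local Open Scope classical_set_scope.
Local Open Scope group_scope.

(** The heart of the matter is that every nontrivial normal subgroup [N] of
   [G = G_omega] contains a level stabiliser. A finite index subgroup of the
   infinite group [G] contains a nontrivial normal subgroup, namely its core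
   ([nontrivial_core]), and level stabilisers have finite index, so this gives
   both conclusions.

   The sequence is not eventually constant ([branch_varying]): for a constant
   sequence the group is infinite dihedral and the rigid stabiliser of a vertex
   of level 1 is trivial. So if the sequence is constant from some place on then
   the rigid stabiliser in [G] of some level is trivial, and cannot have finite
   index.

   Write [d] for a generator [gen_dir k omega], and let [(g, h)] stand for the
   automorphism fixing level 1 with sections [g] and [h], written [node g h]
   below. Four facts about commutators combine.
   - Below a vertex of level [n >= 1], [G] contains the element supported there
     with section [[a, d]], for the generator [d] of index [omega (n - 1)]
     ([iter_rigid_comm]).
   - If a normal subgroup of [G] contains [[a, d_k]] with [k] different from
     [omega 0], its projections to the vertices 1, 11, 111 and so on are
     eventually the whole Grigorchuk group of the shifted sequence
     ([iter_proj_full]).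
   - If [g] in [N] moves the vertex [u] and [x], [y] in [G] are supported below
     [u], then [[x, y]] is in [N] ([rigid_commutators]). Commuting elements of
     the first kind with elements of full projection, at a deeper level,
     shows that [N] contains everything supported below some vertex [v] whose
     section is one of the commutators [[[a, d_k], h]], where [h] runs through
     the Grigorchuk group of the shifted sequence.
   - A normal subgroup [Q] of [G] containing all [[[a, d_k], h]], for one [k]
     different from [omega 0], contains a level stabiliser
     ([even_sections_sub_normal]). Modulo such commutators the group has order
     at most 32, and its elements are distinguished by the parities of the
     numbers of swaps on the levels of the tree, taken for the element and for
     its sections. As the sequence takes two different values, finitely many
     levels determine all parities ([stab_sub_even]).
   By level transitivity, what is supported below [v] can be moved to any
   vertex of the same level, and an element fixing that level is the product of
   its parts below the vertices ([stab_sub_of_vertices]). *)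

(** * Subgroups and normal subgroups *)

Lemma commMgl (gT : groupType) (x y z : gT) :
  [~ x * y, z] = [~ x, z] ^ y * [~ y, z].
Proof. by rewrite /commg /conjg !invgM !mulgA !mulgK. Qed.

Lemma commMgr (gT : groupType) (x y z : gT) :
  [~ x, y * z] = [~ x, z] * [~ x, y] ^ z.
Proof. by rewrite /commg /conjg !invgM !mulgA !mulgK. Qed.

Section Normal.
Variables (gT : groupType) (G : set gT).
Implicit Types N : set gT.

Lemma subgroup_conj (H : set gT) x y : is_subgroup H -> H x -> H y -> H (x ^ y).
Proof. by case=> _ HM HV Hx Hy; apply: HM (HV _ Hy) (HM _ _ Hx Hy). Qed.

Lemma subgroup_comm (H : set gT) x y :
  is_subgroup H -> H x -> H y -> H [~ x, y].
Proof.
move=> sH Hx Hy; case: (sH) => _ HM HV.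
exact: HM (HV _ Hx) (subgroup_conj sH _ _).
Qed.

Lemma subgroup_cancell (H : set gT) x y :
  is_subgroup H -> H x -> H (x * y) -> H y.
Proof.
by case=> _ HM HV Hx Hxy; rewrite -(mulKg x y); apply: HM; first exact: HV.
Qed.

Lemma normal_comml N x g : is_normal G N -> N x -> G g -> N [~ x, g].
Proof. by case=> -[_ NM NV] _ NJ Nx Gg; apply: NM (NV _ Nx) (NJ _ _ Nx Gg). Qed.

Lemma normal_commr N x g : is_normal G N -> N x -> G g -> N [~ g, x].
Proof.
move=> nN Nx Gg; rewrite -invgR; case: (nN) => -[_ _ NV] _ _.
exact/NV/(normal_comml nN).
Qed.

Lemma normal_self : is_subgroup G -> is_normal G G.
Proof. by move=> sG; split=> // x g; apply: subgroup_conj. Qed.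

Lemma normalI N1 N2 :
  is_normal G N1 -> is_normal G N2 -> is_normal G (N1 `&` N2).
Proof.
case=> -[o1 M1 V1] s1 J1 [[o2 M2 V2] s2 J2]; split=> [||x g [x1 x2] Gg].
- split=> [//|x y [x1 x2] [y1 y2]|x [x1 x2]]; split; auto.
- by move=> x [/s1].
- by split; auto.
Qed.

(** The subgroup generated by [N] and [c] when [c] is central and of order at
   most 2 modulo [N], so that [c] and [c^-1] lie in the same coset. *)
Definition adjoin N c : set gT := [set g | N g \/ N (g * c)].

Lemma adjoin_mem N c : is_subgroup N -> c * c = 1 -> adjoin N c c.
Proof. by case=> N1 _ _ cc; right; rewrite cc. Qed.

Lemma adjoinE N c g : adjoin N c g ->
  exists e : bool, N (g * c ^+ e).
Proof. by case=> Ng; [exists false; rewrite mulg1|exists true]. Qed.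

Lemma adjoin_normal N c : is_subgroup G -> is_normal G N -> G c ->
  N (c * c) -> (forall g, G g -> N [~ c, g]) -> is_normal G (adjoin N c).
Proof.
move=> [_ GM GV] [[N1 NM NV] sNG NJ] Gc Ncc Ncg.
have NJ' x g : N (x ^ g) -> G g -> N x.
  by move=> Nxg Gg; rewrite -(conjgK g x); apply: NJ => //; apply: GV.
have NcV : N (c^-1 * c^-1) by rewrite -invgM; apply: NV.
split.
- split=> [|x y [Nx|Nx] [Ny|Ny]|x [Nx|Nx]]; first by left.
  + by left; apply: NM.
  + by right; rewrite -mulgA; apply: NM.
  + right; have -> : x * y * c = (x * c) * y ^ c by rewrite /conjg !mulgA mulgK.
    by apply: NM => //; apply: NJ.
  + left; have -> : x * y = (x * c) * (y * c) ^ c * (c^-1 * c^-1).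
      by rewrite /conjg !mulgA !mulgK.
    by apply: (NM); [apply: NM => //; apply: NJ|].
  + by left; apply: NV.
  + right; apply: (NJ' _ c) => //.
    have -> : (x^-1 * c) ^ c = (x * c)^-1 * (c * c).
      by rewrite invgM /conjg !mulgA.
    by apply: NM => //; apply: NV.
- move=> x [/sNG//|/sNG Gxc]; rewrite -(mulgK c x).
  by apply: GM => //; apply: GV.
- move=> x g [Nx|Nx] Gg; [by left; apply: NJ|right].
  have -> : x ^ g * c = (x * c) ^ g * [~ c, g]^-1.
    by rewrite conjMg invgR /commg /conjg !mulgA !mulgK.
  by apply: NM; [apply: NJ|apply: NV; apply: Ncg].
Qed.

End Normal.

(** * The isomorphism [psi] and its inverse *)

Lemma aut_eq_nil (f : treeAut) v : (f v == [::]) = (v == [::]).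
Proof. by rewrite -{1}(aut_root f) (can_eq (@aut_funK f)). Qed.

Section Node.
Variables g h : treeAut.

Definition node_fun (f k : word -> word) (v : word) : word :=
  match v with
  | [::] => [::]
  | false :: v' => false :: f v'
  | true :: v' => true :: k v'
  end.

Fact node_funK : cancel (node_fun g h) (node_fun (aut_inv g) (aut_inv h)).
Proof. by case=> [|[] v] //=; rewrite aut_funK. Qed.

Fact node_invK : cancel (node_fun (aut_inv g) (aut_inv h)) (node_fun g h).
Proof. by case=> [|[] v] //=; rewrite aut_invK. Qed.

Fact node_adj : {mono node_fun g h : u v / adj u v}.
Proof.
move=> [|x u] [|y v] //.
- by case: y => /=; rewrite !adj_nil aut_eq_nil.
- by rewrite !(adj_sym _ [::]); case: x => /=; rewrite !adj_nil aut_eq_nil.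
- by case: x y => [] [] /=; rewrite !adj_cons ?aut_adj.
Qed.

Definition node : treeAut :=
  @TreeAut (node_fun g h) _ node_funK node_invK erefl node_adj.

End Node.

Local Notation "''a'" := gen_a (at level 0) : group_scope.

Lemma nodeM g h g' h' : node g h * node g' h' = node (g * g') (h * h').
Proof. by apply: treeAutP => -[|[] v]. Qed.

Lemma node1 : node 1 1 = 1.
Proof. by apply: treeAutP => -[|[] v]. Qed.

Lemma nodeV g h : (node g h)^-1 = node g^-1 h^-1.
Proof. by apply: treeAutP => -[|[] v]. Qed.

Lemma nodeJ g h g' h' : node g h ^ node g' h' = node (g ^ g') (h ^ h').
Proof. by rewrite /conjg nodeV !nodeM. Qed.

Lemma nodeR g h g' h' : [~ node g h, node g' h'] = node [~ g, g'] [~ h, h'].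
Proof. by rewrite /commg nodeJ nodeV nodeM. Qed.

Lemma gen_aV : 'a^-1 = 'a.
Proof. exact: treeAutP. Qed.

Lemma gen_aK : 'a * 'a = 1.
Proof. by rewrite -{1}gen_aV mulVg. Qed.

Lemma nodeJa g h : node g h ^ 'a = node h g.
Proof. by rewrite /conjg gen_aV; apply: treeAutP => -[|[] v]. Qed.

Lemma mulang g h : 'a * node g h = node h g * 'a.
Proof. by rewrite [RHS]conjgC nodeJa. Qed.

Lemma nodea_mul g h g' h' :
  node g h * 'a * node g' h' = node (g * h') (h * g') * 'a.
Proof. by rewrite -mulgA mulang mulgA nodeM. Qed.

Lemma nodea_mula g h g' h' :
  node g h * 'a * (node g' h' * 'a) = node (g * h') (h * g').
Proof. by rewrite mulgA nodea_mul -mulgA gen_aK mulg1. Qed.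

Lemma node_inj g h g' h' : node g h = node g' h' -> g = g' /\ h = h'.
Proof.
move=> e; have ev v : node g h v = node g' h' v by rewrite e.
split; apply: treeAutP => v.
- by have [] := ev (false :: v).
- by have [] := ev (true :: v).
Qed.

Lemma node_neq_nodea g h g' h' : node g h <> node g' h' * 'a.
Proof.
by move/(congr1 (fun f : treeAut => f [:: true])).
Qed.

(** * The groups [G_omega] *)

Local Notation Grig := Grigorchuk_group.

Section Grigorchuk.
Implicit Types (omega : nat -> 'I_3) (k l : 'I_3).

Lemma Grig_subgroup omega : is_subgroup (Grig omega).
Proof. exact: generated_subgroup. Qed.

Lemma Grig_a omega : Grig omega 'a.
Proof. by apply: sub_generated; left; left; left. Qed.

Lemma Grig_dir omega k : Grig omega (gen_dir k omega).
Proof.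
apply: sub_generated; case: k => -[|[|[|//]]] lt_k; first by right.
  by left; right.
by left; left; right.
Qed.

Lemma Grig_ind omega (H : set treeAut) : is_subgroup H -> H 'a ->
  (forall k, H (gen_dir k omega)) -> Grig omega `<=` H.
Proof.
move=> sH Ha Hd; apply: smallest_sub => // x [[[->//|->]|->]|->].
- exact: (Hd (@Ordinal 3 2 isT)).
- exact: (Hd (@Ordinal 3 1 isT)).
- exact: (Hd (@Ordinal 3 0 isT)).
Qed.

Definition dir_root omega k : treeAut := if omega 0 == k then 1 else 'a.

Lemma gen_dirE omega k :
  gen_dir k omega = node (dir_root omega k) (gen_dir k (shift omega)).
Proof.
apply: treeAutP => -[|[] v] //=; rewrite /dir_root -val_eqE.
by case: (_ == _).
Qed.

Lemma dir_root_eq omega k : omega 0 = k -> dir_root omega k = 1.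
Proof. by rewrite /dir_root => ->; rewrite eqxx. Qed.

Lemma dir_root_neq omega k : omega 0 != k -> dir_root omega k = 'a.
Proof. by rewrite /dir_root => /negPf->. Qed.

Lemma gen_dirV omega k : (gen_dir k omega)^-1 = gen_dir k omega.
Proof. exact: treeAutP. Qed.

Lemma gen_dirK omega k : gen_dir k omega * gen_dir k omega = 1.
Proof. by rewrite -{1}gen_dirV mulVg. Qed.

Lemma gen_dirC omega k l :
  gen_dir k omega * gen_dir l omega = gen_dir l omega * gen_dir k omega.
Proof.
apply: treeAutP => v /=; elim: v omega => [|[] v IHv] omega //=.
  by rewrite IHv.
by case: ifP; case: ifP.
Qed.

Lemma gen_dirM omega k l m : k != l -> k != m -> l != m ->
  gen_dir k omega * gen_dir l omega = gen_dir m omega.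
Proof.
move=> kl km lm; apply: treeAutP => v /=.
elim: v omega => [|[] v IHv] omega //=; first by rewrite IHv.
congr cons; move: kl km lm {IHv}; rewrite -!val_eqE /=.
case: (omega 0) k l m => -[|[|[|//]]] ? -[[|[|[|//]]] ?] [[|[|[|//]]] ?]
  [[|[|[|//]]] ?] //= _ _ _; by rewrite swap_funK.
Qed.

(** Every element of [G_omega] permutes the first letter by a power of [a], and
   up to this power its sections lie in [G_(shift omega)]. *)
Lemma Grig_decomp omega g : Grig omega g ->
  exists g0 g1, [/\ Grig (shift omega) g0, Grig (shift omega) g1 &
                    g = node g0 g1 \/ g = node g0 g1 * 'a].
Proof.
move: g; have [G1 GM GV] := Grig_subgroup (shift omega).
apply: Grig_ind.
- split=> [|x y [g0 [g1 [Gg0 Gg1 ex]]] [h0 [h1 [Gh0 Gh1 ey]]]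
           |x [g0 [g1 [Gg0 Gg1 ex]]]].
  + by exists 1, 1; split=> //; left; rewrite node1.
  + case: ex => ->.
      exists (g0 * h0), (g1 * h1); split; [exact: GM|exact: GM|].
      by case: ey => ->; [left|right]; rewrite ?mulgA nodeM.
    exists (g0 * h1), (g1 * h0); split; [exact: GM|exact: GM|].
    by case: ey => ->; [right; rewrite nodea_mul|left; rewrite nodea_mula].
  + case: ex => ->.
      by exists g0^-1, g1^-1; split; [exact: GV|exact: GV|left; rewrite nodeV].
    exists g1^-1, g0^-1; split; [exact: GV|exact: GV|right].
    by rewrite invgM nodeV gen_aV mulang.
- by exists 1, 1; split=> //; right; rewrite node1 mul1g.
- move=> k; exists (dir_root omega k), (gen_dir k (shift omega)); split.
  + by rewrite /dir_root; case: ifP => _ //; apply: Grig_a.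
  + exact: Grig_dir.
  + by left; rewrite gen_dirE.
Qed.

Lemma Grig_node omega g h : Grig omega (node g h) ->
  Grig (shift omega) g /\ Grig (shift omega) h.
Proof.
case/Grig_decomp=> g0 [g1 [Gg0 Gg1 [/node_inj[-> ->]//|]]].
by move/node_neq_nodea.
Qed.

Lemma Grig_dirJa omega k :
  Grig omega (node (gen_dir k (shift omega)) (dir_root omega k)).
Proof.
rewrite -nodeJa -gen_dirE; apply: (subgroup_conj (Grig_subgroup omega)).
  exact: Grig_dir.
exact: Grig_a.
Qed.

Lemma letter_neq k : exists l : 'I_3, k != l.
Proof. by case: (eqVneq k ord0) => [->|]; [exists ord_max|exists ord0]. Qed.

(** The first level stabiliser maps onto [G_(shift omega)] at the vertex 1. The
   element [a] is attained because it is a section of every [gen_dir k omega]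
   for which [k] is not the first entry of the sequence. *)
Lemma Grig_proj omega h : Grig (shift omega) h ->
  exists g, Grig omega (node g h).
Proof.
move: h; have [G1 GM GV] := Grig_subgroup omega; apply: Grig_ind.
- split=> [|x y [g Gg] [h Gh]|x [g Gg]].
  + by exists 1; rewrite node1.
  + by exists (g * h); rewrite -nodeM; apply: GM.
  + by exists g^-1; rewrite -nodeV; apply: GV.
- have [k Dk] := letter_neq (omega 0).
  exists (gen_dir k (shift omega)); have := @Grig_dirJa omega k.
  by rewrite dir_root_neq.
- by move=> k; exists (dir_root omega k); rewrite -gen_dirE; apply: Grig_dir.
Qed.

End Grigorchuk.

Arguments Grig_a omega : clear implicits.
Arguments Grig_dir omega k : clear implicits.

(** * Rigid parts and projections of normal subgroups *)

(** The rigid stabiliser in [Q] of the vertex 1, seen as a group acting on the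
   subtree below that vertex. *)
Definition rigid (Q : set treeAut) : set treeAut := [set h | Q (node 1 h)].

(** The projection to the vertex 1 of the stabiliser of level 1 in [Q]. *)
Definition proj (Q : set treeAut) : set treeAut :=
  [set h | exists g, Q (node g h)].

Section RigidProj.
Implicit Types (omega : nat -> 'I_3) (k l : 'I_3) (Q : set treeAut).

Lemma rigid_normal omega Q :
  is_normal (Grig omega) Q -> is_normal (Grig (shift omega)) (rigid Q).
Proof.
case=> -[Q1 QM QV] sQ QJ; split; first split.
- by rewrite /rigid /= node1.
- by move=> x y Qx Qy; have := QM _ _ Qx Qy; rewrite nodeM mulg1.
- by move=> x Qx; have := QV _ Qx; rewrite nodeV invg1.
- by move=> x /sQ /Grig_node[].
- move=> x h Qx /Grig_proj[g Gg].
  by have := QJ _ _ Qx Gg; rewrite nodeJ conj1g.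
Qed.

Lemma proj_normal omega Q :
  is_normal (Grig omega) Q -> is_normal (Grig (shift omega)) (proj Q).
Proof.
case=> -[Q1 QM QV] sQ QJ; split; first split.
- by exists 1; rewrite node1.
- by move=> x y [g Qg] [h Qh]; exists (g * h); rewrite -nodeM; apply: QM.
- by move=> x [g Qg]; exists g^-1; rewrite -nodeV; apply: QV.
- by move=> x [g /sQ /Grig_node[]].
- move=> x h [g Qx] /Grig_proj[g' Gg]; exists (g ^ g').
  by have := QJ _ _ Qx Gg; rewrite nodeJ.
Qed.

Lemma iter_rigid_normal omega Q n : is_normal (Grig omega) Q ->
  is_normal (Grig (iter n shift omega)) (iter n rigid Q).
Proof. by move=> nQ; elim: n => //= n; apply: rigid_normal. Qed.

Lemma iter_rigidE Q n h : iter n rigid Q h = Q (iter n (node 1) h).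
Proof. by elim: n h => //= n IHn h; rewrite [LHS]IHn -iterSr. Qed.

Lemma iter_shift omega n i : iter n shift omega i = omega (n + i).
Proof. by elim: n i => //= n IHn i; rewrite /shift IHn addSnnS. Qed.

Lemma comm_a_dir omega k : let d' := gen_dir k (shift omega) in
  [~ 'a, gen_dir k omega] =
  node (d' * dir_root omega k) (dir_root omega k * d').
Proof.
by rewrite /= commgEr gen_dirV [gen_dir k omega]gen_dirE nodeJa nodeM.
Qed.

(** Let [t] be the generator whose section at the vertex 0 is trivial. If [d]
   is [t] then [[a, d] = (t, t)], whose commutator with a generator
   [y = (a, y)] is [([t, a], 1)]. Otherwise [[a, d] = (d a, a d)], whose commutator with
   [t = (1, t)] is [(1, [a d, t])], where [[a d, t]] is a conjugate of
   [[a, t]]. *)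
Lemma rigid_comm omega Q k : is_normal (Grig omega) Q ->
  Q [~ 'a, gen_dir k omega] ->
  rigid Q [~ 'a, gen_dir (omega 0) (shift omega)].
Proof.
move=> nQ; have nR := rigid_normal nQ.
have [[_ _ QV] _ QJ] := nQ; have [_ _ RJ] := nR.
rewrite comm_a_dir; have [kE|kNE] := eqVneq (omega 0) k.
  rewrite dir_root_eq // mulg1 mul1g kE => Qk.
  have [l Dl] := letter_neq (omega 0).
  have := normal_comml nQ Qk (Grig_dir omega l).
  rewrite [gen_dir l omega]gen_dirE dir_root_neq // nodeR.
  have -> : [~ gen_dir k (shift omega), gen_dir l (shift omega)] = 1.
    by apply/eqP/commgP/gen_dirC.
  move=> /QV; rewrite nodeV invgR invg1 => Qc.
  by have := QJ _ _ Qc (Grig_a omega); rewrite nodeJa.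
rewrite dir_root_neq // => Qk.
have := normal_comml nQ Qk (Grig_dir omega (omega 0)).
rewrite [gen_dir (omega 0) omega]gen_dirE dir_root_eq // nodeR commg1 commMgl.
have -> : [~ gen_dir k (shift omega), gen_dir (omega 0) (shift omega)] = 1.
  by apply/eqP/commgP/gen_dirC.
rewrite mulg1 => Rc; have := RJ _ _ Rc (Grig_dir (shift omega) k).
by rewrite -conjgM gen_dirK conjg1.
Qed.

(** As the generator [t] attached to the first entry is [(1, t)], a commutator
   [[a, t]] is available in the rigid stabiliser of a vertex of level 1, and the
   previous lemma passes it on to all deeper levels. *)
Lemma iter_rigid_comm omega n :
  iter n.+1 rigid (Grig omega)
    [~ 'a, gen_dir (omega n) (iter n.+1 shift omega)].
Proof.
have nG n' := iter_rigid_normal n' (normal_self (Grig_subgroup omega)).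
elim: n => [|n IHn].
  apply: (normal_commr (nG 1%N)); last exact: Grig_a.
  rewrite /= /rigid /= -(dir_root_eq (erefl (omega 0))) -gen_dirE.
  exact: Grig_dir.
have := rigid_comm (nG n.+1) IHn.
by rewrite iter_shift addn0.
Qed.

Definition all_comm omega Q := forall l, Q [~ 'a, gen_dir l omega].

Lemma proj_comm omega Q k : Q [~ 'a, gen_dir k omega] ->
  proj Q (dir_root omega k * gen_dir k (shift omega)).
Proof.
by rewrite comm_a_dir; exists (gen_dir k (shift omega) * dir_root omega k).
Qed.

Lemma proj_dir omega Q k :
  Q (gen_dir k omega) -> proj Q (gen_dir k (shift omega)).
Proof. by rewrite gen_dirE; exists (dir_root omega k). Qed.

Lemma proj_dir_root omega Q k : is_normal (Grig omega) Q ->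
  Q (gen_dir k omega) -> proj Q (dir_root omega k).
Proof.
case=> _ _ QJ Qd; exists (gen_dir k (shift omega)).
by rewrite -nodeJa -gen_dirE; apply: QJ => //; apply: Grig_a.
Qed.

(** Commuting [a d] with [d'] gives a conjugate of [[a, d']], as [d] and [d']
   commute. *)
Lemma comm_of_mul omega Q k : is_normal (Grig omega) Q ->
  Q ('a * gen_dir k omega) -> all_comm omega Q.
Proof.
move=> nQ Qad l; have [_ _ QJ] := nQ.
have := normal_comml nQ Qad (Grig_dir omega l); rewrite commMgl.
have -> : [~ gen_dir k omega, gen_dir l omega] = 1 by apply/eqP/commgP/gen_dirC.
rewrite mulg1 => Qc; have := QJ _ _ Qc (Grig_dir omega k).
by rewrite -conjgM gen_dirK conjg1.
Qed.

Lemma proj_all_comm_start omega Q k : is_normal (Grig omega) Q ->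
  omega 0 != k -> Q [~ 'a, gen_dir k omega] -> all_comm (shift omega) (proj Q).
Proof.
move=> nQ Dk /proj_comm; rewrite dir_root_neq //.
exact: comm_of_mul (proj_normal nQ).
Qed.

Lemma proj_all_comm omega Q : is_normal (Grig omega) Q -> all_comm omega Q ->
  all_comm (shift omega) (proj Q).
Proof.
move=> nQ Qc; have [k Dk] := letter_neq (omega 0).
exact: proj_all_comm_start Dk (Qc k).
Qed.

(** When [omega 0] is not [k] the generator [d_k] has section [a] at a vertex of
   level 1. The commutators [[a, d]] have sections [d] or [a d], which together
   with [a] give all generators. *)
Lemma proj_full omega Q k : is_normal (Grig omega) Q -> all_comm omega Q ->
  Q (gen_dir k omega) -> omega 0 != k -> Grig (shift omega) `<=` proj Q.
Proof.
move=> nQ Qc Qd Dk; have [sP _ _] := proj_normal nQ.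
have Pa : proj Q 'a by rewrite -(dir_root_neq Dk); apply: proj_dir_root.
apply: Grig_ind => // l; have := proj_comm (Qc l).
by rewrite /dir_root; case: ifP => _; [rewrite mul1g|apply: subgroup_cancell].
Qed.

(** As long as [omega 0] is [k], the generator [d_k] and all commutators
   [[a, d]] persist in the projection; the first change of letter gives the
   whole group. *)
Lemma iter_proj_full_wait n omega Q k : is_normal (Grig omega) Q ->
  all_comm omega Q -> Q (gen_dir k omega) -> omega n != k ->
  exists j, Grig (iter j shift omega) `<=` iter j proj Q.
Proof.
elim: n omega Q => [|n IHn] omega Q nQ Qc Qd Dk.
  by exists 1%N; apply: proj_full nQ Qc Qd Dk.
have [||||j Pj] := IHn (shift omega) (proj Q).
- exact: proj_normal.
- exact: proj_all_comm.
- exact: proj_dir.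
- exact: Dk.
- by exists j.+1; rewrite !iterSr.
Qed.

Lemma iter_proj_full_mono omega Q i j : is_normal (Grig omega) Q -> i <= j ->
  Grig (iter i shift omega) `<=` iter i proj Q ->
  Grig (iter j shift omega) `<=` iter j proj Q.
Proof.
move=> nQ /subnK <- Pi; elim: (j - i) => //= n IHn h /Grig_proj[g Gg].
by exists g; apply: IHn.
Qed.

(** In other words, the sequence is not eventually constant. *)
Definition varying omega := forall n, exists2 i, n <= i & omega i != omega i.+1.

Lemma varying_shift omega n : varying omega -> varying (iter n shift omega).
Proof.
move=> vo m; have [i le_i Di] := vo (n + m).
exists (i - n); first by rewrite leq_subRL ?(leq_trans (leq_addr m n)).
have le_ni : n <= i by rewrite (leq_trans (leq_addr m n)).
by rewrite !iter_shift addnS subnKC.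
Qed.

Lemma varying_neq omega k n : varying omega -> exists2 i, n <= i & omega i != k.
Proof.
move=> vo; have [i le_ni Di] := vo n.
have [ik|] := eqVneq (omega i) k; last by exists i.
by exists i.+1; [apply: leqW|rewrite eq_sym -ik].
Qed.

(** The projections of [Q] grow. As [[a, d_k] = (d_k a, a d_k)], the first one
   contains [a d_k], hence all commutators [[a, d]]. One of these is [(t, t)],
   so the second one also contains a generator [t]. It keeps both until the
   sequence leaves the letter of [t], whereupon the projection is the whole
   group. *)
Lemma iter_proj_full omega Q k : varying omega -> is_normal (Grig omega) Q ->
  omega 0 != k -> Q [~ 'a, gen_dir k omega] ->
  exists j0, forall j, j0 <= j ->
    Grig (iter j shift omega) `<=` iter j proj Q.
Proof.
move=> vo nQ Dk Qk.
have nP := proj_normal nQ; have nPP := proj_normal nP.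
have Pc := proj_all_comm_start nQ Dk Qk.
have Pt : proj (proj Q) (gen_dir (omega 1%N) (iter 2 shift omega)).
  by have := proj_comm (Pc (omega 1%N)); rewrite dir_root_eq // mul1g.
have [i _ Di] := varying_neq (omega 1%N) 0 (varying_shift 2 vo).
have [j Pj] := iter_proj_full_wait nPP (proj_all_comm nP Pc) Pt Di.
exists j.+2 => m le_jm; apply: iter_proj_full_mono le_jm _ => //.
by rewrite !iterSr.
Qed.

(** A commutator with an element supported below a vertex depends on the other
   element only through its section there. This is how commutators inside a
   subgroup with a large projection become commutators with the whole group. *)
Lemma comm_rigid_proj j (A B C : set treeAut) :
  (forall x y, A x -> B y -> C [~ x, y]) ->
  forall x y, iter j rigid A x -> iter j proj B y -> iter j rigid C [~ x, y].
Proof.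
move=> ABC; elim: j => //= j IHj x y Ax [g By].
by have := IHj _ _ Ax By; rewrite nodeR comm1g.
Qed.

End RigidProj.

(** * Level parities and congruence subgroups *)

(** The parity of the number of vertices of level [i] at which [f] swaps the two
   children. *)
Fixpoint level_parity i (f : word -> word) : bool :=
  match i with
  | 0 => head false (f [:: false])
  | i'.+1 => level_parity i' (fun v => behead (f (false :: v)))
             (+) level_parity i' (fun v => behead (f (true :: v)))
  end.

Section LevelParity.
Implicit Types (omega : nat -> 'I_3) (k l : 'I_3) (Q : set treeAut).

Lemma level_parity_node i g h :
  level_parity i.+1 (node g h) = level_parity i g (+) level_parity i h.
Proof. by []. Qed.

Lemma level_parity_nodea i g h :
  level_parity i.+1 (node g h * 'a) = level_parity i g (+) level_parity i h.
Proof. by []. Qed.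

Lemma level_parityM i omega x y : Grig omega x -> Grig omega y ->
  level_parity i (x * y) = level_parity i x (+) level_parity i y.
Proof.
elim: i omega x y => [|i IHi] omega x y /Grig_decomp[g0 [g1 [Gg0 Gg1 ex]]]
  /Grig_decomp[h0 [h1 [Gh0 Gh1 ey]]].
  by case: ex => ->; case: ey => ->.
have perm4 a b c d : (a (+) b) (+) (c (+) d) = (a (+) c) (+) (b (+) d).
  by case: a b c d => [] [] [] [].
case: ex => ->; case: ey => ->.
- by rewrite nodeM !level_parity_node !(IHi (shift omega)) // perm4.
- by rewrite mulgA nodeM !level_parity_nodea !(IHi (shift omega)) // perm4.
- rewrite nodea_mul level_parity_node !level_parity_nodea.
  rewrite !(IHi (shift omega)) //.
  by rewrite perm4 [X in _ (+) X]addbC.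
- rewrite nodea_mula level_parity_node !level_parity_nodea.
  rewrite !(IHi (shift omega)) //.
  by rewrite perm4 [X in _ (+) X]addbC.
Qed.

Lemma level_parity1 i : level_parity i (1 : treeAut) = false.
Proof.
have [G1 _ _] := Grig_subgroup (fun=> ord0).
by have := level_parityM i G1 G1; rewrite mulg1 addbb.
Qed.

Lemma level_parityV i omega x : Grig omega x ->
  level_parity i (x^-1) = level_parity i x.
Proof.
move=> Gx; have [_ _ GV] := Grig_subgroup omega.
have := level_parityM i (GV _ Gx) Gx; rewrite mulVg level_parity1.
by case: level_parity; case: level_parity.
Qed.

Lemma level_parityJ i omega x g : Grig omega x -> Grig omega g ->
  level_parity i (x ^ g) = level_parity i x.
Proof.
move=> Gx Gg; have [_ GM GV] := Grig_subgroup omega.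
rewrite /conjg !(@level_parityM i omega) ?(level_parityV i Gg); auto.
by case: level_parity; case: level_parity.
Qed.

Lemma level_parityR i omega x g : Grig omega x -> Grig omega g ->
  level_parity i [~ x, g] = false.
Proof.
move=> Gx Gg; rewrite /commg (@level_parityM i omega).
- by rewrite (level_parityV i Gx) (level_parityJ i Gx Gg) addbb.
- by have [_ _ GV] := Grig_subgroup omega; apply: GV.
- exact: subgroup_conj (Grig_subgroup omega) Gx Gg.
Qed.

Lemma level_parity_a i : level_parity i 'a = (i == 0).
Proof. by case: i => //= i; rewrite addbb. Qed.

Lemma level_parity_dir0 omega k : level_parity 0 (gen_dir k omega) = false.
Proof. by []. Qed.

Lemma level_parity_dirS i omega k :
  level_parity i.+1 (gen_dir k omega) = (omega i != k).
Proof.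
elim: i omega => [|i IHi] omega; rewrite gen_dirE level_parity_node.
  by rewrite level_parity_dir0 addbF /dir_root; case: ifP => _.
rewrite IHi /dir_root; case: ifP => _; first by rewrite level_parity1.
by rewrite level_parity_a.
Qed.

Definition even omega : set treeAut :=
  [set g | Grig omega g /\ forall i, level_parity i g = false].

Lemma even_normal omega : is_normal (Grig omega) (even omega).
Proof.
have [G1 GM GV] := Grig_subgroup omega; split; first split.
- by split=> // i; apply: level_parity1.
- move=> x y [Gx Ex] [Gy Ey]; split=> [|i]; first exact: GM.
  by rewrite (@level_parityM i omega) // Ex Ey.
- move=> x [Gx Ex]; split=> [|i]; first exact: GV.
  by rewrite (level_parityV i Gx).
- by move=> x [].
- move=> x g [Gx Ex] Gg; split=> [|i]; last first.
    by rewrite (level_parityJ i Gx Gg).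
  exact: (subgroup_conj (Grig_subgroup omega)).
Qed.

Lemma even_comm omega x g : Grig omega x -> Grig omega g -> even omega [~ x, g].
Proof.
move=> Gx Gg; split=> [|i]; first exact: (subgroup_comm (Grig_subgroup omega)).
exact: level_parityR Gx Gg.
Qed.

(** The map [j |-> (j != k)] gives the parities of [gen_dir k omega] and takes
   the value [true] at exactly two letters. Hence for every [g] the parities
   depend on the letters through a function [f] of sum zero, which vanishes as
   soon as it vanishes at two letters. *)
Lemma level_parity_form omega g : Grig omega g ->
  exists f : nat -> bool, f 0 (+) f 1%N (+) f 2 = false /\
    forall i, level_parity i.+1 g = f (omega i).
Proof.
move=> Gg; suff [] : Grig omega g /\ exists f : nat -> bool,
  f 0 (+) f 1%N (+) f 2 = false /\
  forall i, level_parity i.+1 g = f (omega i) by [].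
have [G1 GM GV] := Grig_subgroup omega.
move: g Gg; apply: Grig_ind.
- split=> [|x y [Gx [f [f0 fE]]] [Gy [h [h0 hE]]]|x [Gx [f [f0 fE]]]].
  + by split=> //; exists xpred0; split=> // i; rewrite level_parity1.
  + split; first exact: GM.
    exists (fun j => f j (+) h j); split=> [|i].
      by move: f0 h0; do 3!case: (f _); do 3!case: (h _).
    by rewrite (level_parityM _ Gx Gy) fE hE.
  + split; first exact: GV.
    by exists f; split=> // i; rewrite (level_parityV _ Gx).
- split; first exact: Grig_a.
  by exists xpred0; split=> // i; rewrite level_parity_a.
- move=> k; split; first exact: Grig_dir.
  exists (fun j => j != k :> nat); split; last first.
    by move=> i; rewrite level_parity_dirS -val_eqE.
  by case: k => -[|[|[|//]]].
Qed.

Lemma level_stab_node omega n g : level_stab (Grig omega) n.+1 g ->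
  exists g0 g1, [/\ g = node g0 g1, level_stab (Grig (shift omega)) n g0 &
                    level_stab (Grig (shift omega)) n g1].
Proof.
case=> Gg gE; have [g0 [g1 [Gg0 Gg1 [eg|eg]]]] := Grig_decomp Gg; subst g.
  have gE' v : size v = n -> g0 v = v /\ g1 v = v.
    move=> szv; have /= := gE (true :: v); have /= := gE (false :: v).
    by rewrite szv => /(_ erefl)[->] /(_ erefl)[->].
  by exists g0, g1; do 2!split=> //; move=> v /gE'[].
have /= := gE (false :: nseq n false); rewrite size_nseq => /(_ erefl).
by [].
Qed.

Lemma level_parity_stab omega n i g : i < n -> level_stab (Grig omega) n g ->
  level_parity i g = false.
Proof.
elim: n i omega g => // n IHn [|i] omega g lt_in;
  case/level_stab_node=> g0 [g1 [-> s0 s1]] //.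
by rewrite level_parity_node (IHn _ _ _ _ s0) // (IHn _ _ _ _ s1).
Qed.

(** A place where the sequence changes shows two different letters, and then the
   parities at finitely many levels determine all of them. *)
Lemma stab_sub_even omega : varying omega ->
  exists m, level_stab (Grig omega) m `<=` even omega.
Proof.
move=> /(_ 0)[i _ Di]; exists i.+3 => g sg; have [Gg _] := sg; split=> // -[|j].
  exact: level_parity_stab sg.
have [f [f0 fE]] := level_parity_form Gg.
have := level_parity_stab (ltnW (ltnSn i.+2)) sg.
have := level_parity_stab (ltnSn i.+2) sg.
rewrite !fE; move: Di f0; rewrite -val_eqE /=.
case: (omega i) => -[|[|[|//]]] ? /=;
case: (omega i.+1) => -[|[|[|//]]] ? //= _ f0 f1 f2;
case: (omega j) => -[|[|[|//]]] ? //=; by move: f0; rewrite f1 f2; case: (f _).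
Qed.

Definition even_sections omega : set treeAut :=
  [set g | Grig omega g /\ exists g0 g1,
    [/\ g = node g0 g1, even (shift omega) g0 & even (shift omega) g1]].

Lemma even_sections_sub omega : even_sections omega `<=` even omega.
Proof.
move=> g [Gg [g0 [g1 [eg [_ E0] [_ E1]]]]]; split=> // i; rewrite eg.
by case: i => // i; rewrite level_parity_node E0 E1.
Qed.

Lemma even_sections_normal omega : is_normal (Grig omega) (even_sections omega).
Proof.
have [G1 GM GV] := Grig_subgroup omega.
have [[E1 EM EV] _ EJ] := even_normal (shift omega).
have UJa x : even_sections omega x -> even_sections omega (x ^ 'a).
  case=> Gx [g0 [g1 [ex E0 E1']]]; split.
    exact: (subgroup_conj (Grig_subgroup omega)) (Grig_a _).
  by exists g1, g0; rewrite ex nodeJa.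
split; first split.
- by split=> //; exists 1, 1; rewrite node1.
- move=> x y [Gx [g0 [g1 [ex ? ?]]]] [Gy [h0 [h1 [ey ? ?]]]].
  split; first exact: GM.
  by exists (g0 * h0), (g1 * h1); rewrite ex ey nodeM; split; auto.
- move=> x [Gx [g0 [g1 [ex ? ?]]]]; split; first exact: GV.
  by exists g0^-1, g1^-1; rewrite ex nodeV; split; auto.
- by move=> x [].
- move=> x g Ux Gg.
  have UJn h0 h1 : Grig omega (node h0 h1) ->
      even_sections omega (x ^ node h0 h1).
    move=> Gh; case: Ux => Gx [g0 [g1 [ex E0 E1']]]; split.
      exact: (subgroup_conj (Grig_subgroup omega)).
    have [Gh0 Gh1] := Grig_node Gh.
    by exists (g0 ^ h0), (g1 ^ h1); rewrite ex nodeJ; split; auto.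
  have [h0 [h1 [_ _ [eg|eg]]]] := Grig_decomp Gg; rewrite eg.
    by apply: UJn; rewrite -eg.
  rewrite conjgM; apply/UJa/UJn; rewrite -(mulgK 'a (node _ _)) -eg gen_aV.
  by apply: GM => //; apply: Grig_a.
Qed.

End LevelParity.

Section Congruence.
Implicit Types (omega : nat -> 'I_3) (k l : 'I_3) (Q N : set treeAut).

Lemma Grig_ind2 omega k l (H : set treeAut) : k != l -> is_subgroup H -> H 'a ->
  H (gen_dir k omega) -> H (gen_dir l omega) -> Grig omega `<=` H.
Proof.
move=> Dkl sH Ha Hk Hl; apply: Grig_ind => // m.
have [<-//|Dkm] := eqVneq k m; have [<-//|Dlm] := eqVneq l m.
by rewrite -(gen_dirM omega Dkl Dkm Dlm); case: sH => _ HM _; apply: HM.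
Qed.

Lemma comm_centralize omega k l N x : k != l -> is_normal (Grig omega) N ->
  N [~ x, 'a] -> N [~ x, gen_dir k omega] -> N [~ x, gen_dir l omega] ->
  forall g, Grig omega g -> N [~ x, g].
Proof.
move=> Dkl nN Na Nk Nl g Gg; have [[N1 NM NV] _ NJ] := nN.
have [G1 GM GV] := Grig_subgroup omega.
suff [] : Grig omega g /\ N [~ x, g] by [].
move: g Gg; apply: (Grig_ind2 Dkl).
- split=> [|g h [Gg Ng] [Gh Nh]|g [Gg Ng]].
  + by split=> //; rewrite commg1.
  + by split; [exact: GM|rewrite commMgr; apply: NM => //; apply: NJ].
  + split; first exact: GV.
    have -> : [~ x, g^-1] = [~ x, g]^-1 ^ g^-1.
      by rewrite /commg /conjg !invgM !invgK !mulgA mulgV mul1g.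
    by apply: NJ; [apply: NV|apply: GV].
- by split=> //; apply: Grig_a.
- by split=> //; apply: Grig_dir.
- by split=> //; apply: Grig_dir.
Qed.

Lemma level_parityX i omega c (e : bool) : Grig omega c ->
  level_parity i (c ^+ e) = e && level_parity i c.
Proof. by case: e => //=; rewrite level_parity1. Qed.

Section BoundedQuotient.
Variables (omega : nat -> 'I_3) (k : 'I_3).
Hypothesis k_neq : k != omega 0.

Local Notation x := (gen_dir k omega).
Local Notation t := (gen_dir (omega 0) omega).
Local Notation c := [~ 'a, x].
Local Notation r := [~ 'a, t].
Local Notation x' := (gen_dir k (shift omega)).
Local Notation t' := (gen_dir (omega 0) (shift omega)).

Let sG := Grig_subgroup omega.

Let Gc : Grig omega c.
Proof. exact: subgroup_comm sG (Grig_a _) (Grig_dir _ _). Qed.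

Let Gr : Grig omega r.
Proof. exact: subgroup_comm sG (Grig_a _) (Grig_dir _ _). Qed.

Let tE : t = node 1 t'.
Proof. by rewrite gen_dirE dir_root_eq. Qed.

Let cE : c = node (x' * 'a) ('a * x').
Proof. by rewrite comm_a_dir dir_root_neq // eq_sym. Qed.

Let rE : r = node t' t'.
Proof. by rewrite comm_a_dir dir_root_eq // mulg1 mul1g. Qed.

Let Gxa' : Grig (shift omega) (x' * 'a).
Proof.
by case: (Grig_subgroup (shift omega)) => _ GM _; apply: GM;
  [apply: Grig_dir|apply: Grig_a].
Qed.

Let Gax' : Grig (shift omega) ('a * x').
Proof.
by case: (Grig_subgroup (shift omega)) => _ GM _; apply: GM;
  [apply: Grig_a|apply: Grig_dir].
Qed.

Let cV : c^-1 = c ^ 'a.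
Proof. by rewrite cE nodeV nodeJa !invgM gen_aV gen_dirV. Qed.

Lemma comm_even_sections g : Grig omega g -> even_sections omega [~ c, g].
Proof.
have [_ GM GV] := sG; have [_ GM' _] := Grig_subgroup (shift omega).
have [[_ UM _] _ UJ] := even_sections_normal omega.
have Uca : even_sections omega [~ c, 'a].
  split; first exact: (subgroup_comm sG Gc (Grig_a _)).
  exists ('a * x' * ('a * x')), (x' * 'a * (x' * 'a)).
  split; first by rewrite commgEl cV cE nodeJa nodeM.
    split=> [|i]; first exact: GM'.
    by rewrite (@level_parityM i (shift omega)) ?addbb.
  split=> [|i]; first exact: GM'.
  by rewrite (@level_parityM i (shift omega)) ?addbb.
have Ucn h0 h1 : Grig omega (node h0 h1) ->
    even_sections omega [~ c, node h0 h1].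
  move=> Gh; have [Gh0 Gh1] := Grig_node Gh.
  split; first exact: (subgroup_comm sG Gc Gh).
  exists [~ x' * 'a, h0], [~ 'a * x', h1]; split; first by rewrite cE nodeR.
    exact: even_comm.
  exact: even_comm.
move=> Gg; have [h0 [h1 [_ _ [eg|eg]]]] := Grig_decomp Gg; rewrite eg.
  by apply: Ucn; rewrite -eg.
rewrite commMgr; apply: (UM) => //; apply: UJ (Grig_a _); apply: Ucn.
rewrite -(mulgK 'a (node _ _)) -eg gen_aV; apply: GM => //; exact: Grig_a.
Qed.

(** Modulo a normal subgroup [Q] in which [c = [a, x]] is central, the group is
   generated by the involutions [a], [x] and [t], with [x] and [t] commuting.
   Each of [c], [x], [r = [a, t]], [a], [t] is central and of order at most 2
   modulo [Q] and the elements before it in this list, so that the index of [Q]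
   is at most 32. *)
Lemma quotient_normal_form Q g : is_normal (Grig omega) Q ->
  (forall h, Grig omega h -> Q [~ c, h]) -> Grig omega g ->
  exists e1 e2 e3 e4 e5 : bool,
    Q (g * t ^+ e5 * 'a ^+ e4 * r ^+ e3 * x ^+ e2 * c ^+ e1).
Proof.
move=> nQ Qc Gg.
have Ga := Grig_a omega; have Gx := Grig_dir omega k.
have Gt := Grig_dir omega (omega 0).
have xt : [~ x, t] = 1 by apply/eqP/commgP/gen_dirC.
have tx : [~ t, x] = 1 by apply/eqP/commgP/gen_dirC.
have Qcc : Q (c * c).
  have -> : c * c = [~ c, 'a]^-1.
    by rewrite invgR [RHS]commgEr cV -conjgM gen_aK conjg1.
  by have [[_ _ QV] _ _] := nQ; apply/QV/Qc.
have one_in N : is_normal (Grig omega) N -> N 1 by case=> -[].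
have nN1 := adjoin_normal sG nQ Gc Qcc Qc; set N1 := adjoin Q c in nN1.
have N1c : N1 c by right.
have nN2 : is_normal (Grig omega) (adjoin N1 x).
  apply: adjoin_normal => //; first by rewrite gen_dirK; apply: one_in.
  apply: (comm_centralize (k := k) (l := omega 0)) => //.
  - by rewrite -invgR; case: (nN1) => -[_ _ NV _ _]; apply: NV.
  - by rewrite commgg; apply: one_in.
  - by rewrite xt; apply: one_in.
set N2 := adjoin N1 x in nN2.
have N2x : N2 x by apply: adjoin_mem; [case: nN1|rewrite gen_dirK].
have nN3 : is_normal (Grig omega) (adjoin N2 r).
  apply: adjoin_normal => //.
    by rewrite rE nodeM gen_dirK node1; apply: one_in.
  apply: (comm_centralize (k := k) (l := omega 0)) => //.
  - by rewrite commgEl rE nodeJa mulVg; apply: one_in.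
  - exact: normal_commr nN2 N2x Gr.
  - by rewrite rE tE nodeR commg1 commgg node1; apply: one_in.
set N3 := adjoin N2 r in nN3.
have N3r : N3 r.
  by apply: adjoin_mem; [case: nN2|rewrite rE nodeM gen_dirK node1].
have N3x : N3 x by left.
have nN4 : is_normal (Grig omega) (adjoin N3 'a).
  apply: adjoin_normal => //; first by rewrite gen_aK; apply: one_in.
  apply: (comm_centralize (k := k) (l := omega 0)) => //.
  - by rewrite commgg; apply: one_in.
  - exact: normal_commr nN3 N3x Ga.
set N4 := adjoin N3 'a in nN4.
have N4a : N4 'a by apply: adjoin_mem; [case: nN3|rewrite gen_aK].
have nN5 : is_normal (Grig omega) (adjoin N4 t).
  apply: adjoin_normal => //; first by rewrite gen_dirK; apply: one_in.
  apply: (comm_centralize (k := k) (l := omega 0)) => //.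
  - exact: normal_commr nN4 N4a Gt.
  - by rewrite tx; apply: one_in.
  - by rewrite commgg; apply: one_in.
have GN5 : Grig omega `<=` adjoin N4 t.
  apply: (Grig_ind2 k_neq); first by case: nN5.
  - by left.
  - by left; left.
  - by apply: adjoin_mem; [case: nN4|rewrite gen_dirK].
have [e5 /adjoinE[e4 /adjoinE[e3 /adjoinE[e2 /adjoinE[e1 Qg]]]]] :=
  adjoinE (GN5 g Gg).
by exists e1, e2, e3, e4, e5.
Qed.

(** Replacing [Q] by its intersection with [even_sections omega] keeps [c]
   central modulo [Q]. Then the 32 normal forms are told apart by parities:
   those of the element itself detect [a], [x] and [t], and those of its
   sections detect [c = (x a, a x)] and [r = (t, t)]. *)
Lemma even_sections_sub_normal Q : varying omega ->
  is_normal (Grig omega) Q -> (forall h, Grig omega h -> Q [~ c, h]) ->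
  even_sections omega `<=` Q.
Proof.
move=> vo nQ Qc g Ug.
have [_ Eg] := even_sections_sub Ug; have [Gg _] := Ug.
have Ga := Grig_a omega; have Gx := Grig_dir omega k.
have Gt := Grig_dir omega (omega 0); have [_ GM _] := sG.
have [e1 [e2 [e3 [e4 [e5 Qg]]]]] : exists e1 e2 e3 e4 e5 : bool,
    (Q `&` even_sections omega)
      (g * t ^+ e5 * 'a ^+ e4 * r ^+ e3 * x ^+ e2 * c ^+ e1).
  apply: quotient_normal_form (Gg).
    exact: normalI nQ (even_sections_normal omega).
  by move=> h Gh; split; [apply: Qc|apply: comm_even_sections].
have GX y (e : bool) : Grig omega y -> Grig omega (y ^+ e).
  by case: e => // _; case: sG.
have parity i : e5 && level_parity i t (+) (e4 && level_parity i 'a)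
    (+) (e2 && level_parity i x) = false.
  have [_ /even_sections_sub[_ /(_ i)]] := Qg.
  rewrite !(@level_parityM i omega);
    try by do ?[apply: (GM); last by apply: GX]; try apply: GX.
  rewrite !(@level_parityX i omega) // Eg.
  have [_ /(_ i)->] := even_comm Ga Gx; have [_ /(_ i)->] := even_comm Ga Gt.
  by rewrite !andbF !addbF.
have e4F : e4 = false.
  have := parity 0.
  by rewrite !level_parity_dir0 !andbF level_parity_a andbT addbF.
have e2F : e2 = false.
  have := parity 1%N; rewrite !level_parity_dirS eqxx level_parity_a !andbF.
  by rewrite eq_sym k_neq andbT.
have [n _ Dn] := varying_neq (omega 0) 0 vo.
have e5F : e5 = false.
  have := parity n.+1; rewrite !level_parity_dirS level_parity_a Dn e2F.
  by rewrite andbT andbF !addbF.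
subst e2 e4 e5; rewrite !mulg1 in Qg.
have [_ [g0 [g1 [eg _ [Gg1 Eg1]]]]] := Ug.
have [_ [_ [h0 [h1 [eh _ [_ Eh1]]]]]] := Qg.
have h1E : h1 = g1 * t' ^+ e3 * ('a * x') ^+ e1.
  have : node h0 h1 =
      node (g0 * t' ^+ e3 * (x' * 'a) ^+ e1) (g1 * t' ^+ e3 * ('a * x') ^+ e1).
    by rewrite -eh eg rE cE; case: (e3); case: (e1); rewrite ?mulg1 ?nodeM.
  by case/node_inj.
have parity' i : e3 && level_parity i t' (+)
    (e1 && (level_parity i 'a (+) level_parity i x')) = false.
  have := Eh1 i; rewrite h1E.
  have [G1' GM' _] := Grig_subgroup (shift omega).
  have Gt' := Grig_dir (shift omega) (omega 0).
  have Gt3 : Grig (shift omega) (t' ^+ e3) by case: (e3).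
  have Ga1 : Grig (shift omega) (('a * x') ^+ e1) by case: (e1).
  have Gg1t := GM' _ _ Gg1 Gt3.
  rewrite 2?(@level_parityM i (shift omega)) //.
  rewrite !(@level_parityX i (shift omega)) //.
  by rewrite (@level_parityM i (shift omega)) ?Eg1 //;
    [apply: Grig_a|apply: Grig_dir].
have [n' _ Dn'] := varying_neq (omega 0) 0 (varying_shift 1 vo).
have e1F : e1 = false.
  have := parity' 0.
  by rewrite !level_parity_dir0 level_parity_a !andbF andbT.
have e3F : e3 = false.
  by have := parity' n'.+1; rewrite e1F level_parity_dirS Dn' andbT addbF.
by have [] := Qg; rewrite e1F e3F !mulg1.
Qed.

End BoundedQuotient.

End Congruence.

(** * Automorphisms supported below a vertex *)

Fixpoint at_vertex (u : word) (x : treeAut) : treeAut :=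
  match u with
  | [::] => x
  | false :: u' => node (at_vertex u' x) 1
  | true :: u' => node 1 (at_vertex u' x)
  end.

Section Vertices.
Implicit Types (omega : nat -> 'I_3) (u v : word) (N : set treeAut).

Lemma at_vertex_nseq n x : at_vertex (nseq n true) x = iter n (node 1) x.
Proof. by elim: n => //= n ->. Qed.

Lemma at_vertexV u x : (at_vertex u x)^-1 = at_vertex u x^-1.
Proof. by elim: u => [|[] u IHu] //=; rewrite nodeV IHu invg1. Qed.

Lemma at_vertexR u x y :
  [~ at_vertex u x, at_vertex u y] = at_vertex u [~ x, y].
Proof. by elim: u => [|[] u IHu] //=; rewrite nodeR IHu comm1g. Qed.

Lemma at_vertex_comm u v x y : size u = size v -> u != v ->
  [~ at_vertex u x, at_vertex v y] = 1.
Proof.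
elim: u v => [|b u IHu] [|c v] //= [szuv]; rewrite eqseq_cons negb_and.
case: b; case: c => //= Duv; rewrite nodeR ?comm1g ?commg1 ?node1 //;
  by rewrite IHu ?node1.
Qed.

(** The section [h] of [g] at [u] lies in the Grigorchuk group of the shifted
   sequence, and describes both the action of [g] below [u] and conjugation by
   [g] of what is supported there. *)
Lemma Grig_section omega u g : Grig omega g ->
  exists h, [/\ Grig (iter (size u) shift omega) h, size (g u) = size u,
    forall v, g (u ++ v) = g u ++ h v &
    forall x, at_vertex u x ^ g = at_vertex (g u) (x ^ h)].
Proof.
elim: u omega g => [|b u IHu] omega g Gg.
  by exists g; rewrite aut_root.
have [g0 [g1 [Gg0 Gg1 eg]]] := Grig_decomp Gg.
have [h [Gh szh hE hJ]] := IHu (shift omega) (if b then g1 else g0)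
  ltac:(by case: (b)).
exists h; split.
- by rewrite /= -iterS iterSr.
- by case: eg => ->; move: szh; case: (b) => /= ->.
- by move=> v; case: eg => ->; case: (b) hE => /= ->.
- move=> x; case: eg => ->; rewrite ?conjgM; case: (b) hJ => /= hJ;
  by rewrite nodeJ hJ conj1g ?nodeJa.
Qed.

Lemma moved_nseq omega g n m : Grig omega g -> n <= m ->
  g (nseq n true) != nseq n true -> g (nseq m true) != nseq m true.
Proof.
move=> Gg /subnKC<-; apply: contra_neq; rewrite nseqD.
have [h [_ szg -> _]] := Grig_section (nseq n true) Gg.
by move/eqP; rewrite eqseq_cat // => /andP[/eqP].
Qed.

(** If [g] moves the vertex [u], then [x ^ g] commutes with [x] and [y]
   whenever these are supported below [u], whence
   [[~ [~ x^-1, g], y] = [~ x, y]]. *)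
Lemma rigid_commutators omega N g n : is_normal (Grig omega) N -> N g ->
  g (nseq n true) != nseq n true ->
  forall x y, iter n rigid (Grig omega) x -> iter n rigid (Grig omega) y ->
  iter n rigid N [~ x, y].
Proof.
move=> nN Ng Dg x y; rewrite !iter_rigidE -!at_vertex_nseq -at_vertexR.
set u := nseq n true in Dg *; set Y := at_vertex u y => GX GY.
have [_ sNG _] := nN; have Gg := sNG _ Ng.
have GXV : Grig omega (at_vertex u x^-1).
  by rewrite -at_vertexV; case: (Grig_subgroup omega) => _ _; apply.
have [h [_ szg _ gJ]] := Grig_section u Gg.
have eg : [~ at_vertex u x^-1, g] = at_vertex u x * at_vertex (g u) (x^-1 ^ h).
  by rewrite /commg gJ at_vertexV invgK.
have := normal_comml nN (normal_commr nN Ng GXV) GY.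
rewrite eg commMgl [X in _ * X]at_vertex_comm // mulg1.
set z := at_vertex (g u) _.
suff -> : [~ at_vertex u x, Y] ^ z = [~ at_vertex u x, Y] by [].
by apply/conjg_fixP; rewrite at_vertexR at_vertex_comm // eq_sym.
Qed.

Lemma stab_sub_of_vertices n m omega N : is_subgroup N ->
  (forall u z, size u = n -> level_stab (Grig (iter n shift omega)) m z ->
     N (at_vertex u z)) ->
  level_stab (Grig omega) (n + m) `<=` N.
Proof.
elim: n omega N => [|n IHn] omega N [N1 NM NV] Nu g.
  by move=> sg; apply: (Nu [::]).
case/level_stab_node=> g0 [g1 [-> s0 s1]].
have -> : node g0 g1 = node g0 1 * node 1 g1 by rewrite nodeM mulg1 mul1g.
apply: (NM).
- apply: (IHn (shift omega) [set z | N (node z 1)]) s0; first split.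
  + by rewrite /= node1.
  + by move=> x y Nx Ny; have := NM _ _ Nx Ny; rewrite nodeM mulg1.
  + by move=> x Nx; have := NV _ Nx; rewrite nodeV invg1.
  + move=> u z szu sz; apply: (Nu (false :: u)); first by rewrite /= szu.
    by rewrite iterSr.
- apply: (IHn (shift omega) [set z | N (node 1 z)]) s1; first split.
  + by rewrite /= node1.
  + by move=> x y Nx Ny; have := NM _ _ Nx Ny; rewrite nodeM mulg1.
  + by move=> x Nx; have := NV _ Nx; rewrite nodeV invg1.
  + move=> u z szu sz; apply: (Nu (true :: u)); first by rewrite /= szu.
    by rewrite iterSr.
Qed.

Lemma stab_sub_even_sections omega : varying omega ->
  exists m, level_stab (Grig omega) m `<=` even_sections omega.
Proof.
move=> vo; have [m sm] := stab_sub_even (varying_shift 1 vo).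
exists m.+1 => g sg; have [Gg _] := sg; split=> //.
have [g0 [g1 [-> s0 s1]]] := level_stab_node sg.
by exists g0, g1; split=> //; apply: sm.
Qed.

Lemma nontrivial_normal_moves omega N : level_transitive (Grig omega) ->
  is_normal (Grig omega) N -> N <> [set 1] ->
  exists g n, N g /\ g (nseq n true) != nseq n true.
Proof.
move=> tG nN N1; have [[No _ _] sNG NJ] := nN.
have [g [Ng Dg]] : exists g, N g /\ g <> 1.
  apply: contra_notP N1 => /forallNP N1.
  apply/seteqP; split=> x /= => [Nx|-> //].
  by apply: contrapT => Dx; apply: (N1 x).
have [v Dv] : exists v, g v != v.
  apply: contra_notP Dg => /forallNP gE; apply: treeAutP => v.
  by apply/eqP/negPn/negP/gE.
have [h Gh hE] := tG (size v) v (nseq (size v) true) erefl (size_nseq _ _).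
exists (g ^ h), (size v); split; first exact: NJ.
have -> : (g ^ h) (nseq (size v) true) = h (g v).
  by rewrite -hE /conjg; congr (h (g _)); apply: aut_funK.
by rewrite -hE (can_eq (@aut_funK h)).
Qed.

(** Let [g] in [N] move a vertex of level [n], and let [L] be the rigid
   stabiliser in [G] of a vertex below it. The rigid stabiliser of this vertex
   in [N] contains [[L, L]]. Far enough below, the projection of [L] is the
   whole group [G_rho], so the rigid stabiliser in [N] contains all commutators
   [[[a, d], y]] with [y] in [G_rho], and thus a level stabiliser of [G_rho].
   Both levels are chosen right after a change of the sequence. Conjugation
   carries the conclusion to all vertices of the level. *)
Theorem normal_congruence omega N : varying omega ->
  level_transitive (Grig omega) -> is_normal (Grig omega) N -> N <> [set 1] ->
  exists m, level_stab (Grig omega) m `<=` N.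
Proof.
move=> vo tG nN N1; have [g [n [Ng Dg]]] := nontrivial_normal_moves tG nN N1.
have Gg : Grig omega g by case: nN => _ sN _; apply: sN.
have [i le_ni Di] := vo n.
set tau := iter i.+1 shift omega; set L := iter i.+1 rigid (Grig omega).
have nL : is_normal (Grig tau) L.
  exact: iter_rigid_normal (normal_self (Grig_subgroup omega)).
have Dtau : tau 0 != omega i by rewrite /tau iter_shift addn0 eq_sym.
have [j0 Pj] :=
  iter_proj_full (varying_shift i.+1 vo) nL Dtau (iter_rigid_comm omega i).
have [i2 le_i2 Di2] := vo (i + j0).
have le_ii2 : i <= i2 by apply: leq_trans (leq_addr _ _) le_i2.
have {Pj} := Pj (i2 - i); rewrite leq_subRL // => /(_ le_i2) Pj.
have lvlE : i2 - i + i.+1 = i2.+1 by rewrite addnS subnK.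
rewrite -iterD lvlE in Pj.
set rho := iter i2.+1 shift omega in Pj.
have Qc x y : iter i2.+1 rigid (Grig omega) x -> Grig rho y ->
    iter i2.+1 rigid N [~ x, y].
  rewrite -lvlE !iterD => Lx /Pj Py.
  apply: (comm_rigid_proj _ Lx Py); apply: (rigid_commutators nN Ng).
  exact: moved_nseq Gg (leqW le_ni) Dg.
have nQ := iter_rigid_normal i2.+1 nN; rewrite -/rho in nQ.
have vrho : varying rho by apply: varying_shift.
have Drho : omega i2 != rho 0 by rewrite /rho iter_shift addn0.
have [m sm] := stab_sub_even_sections vrho.
have UQ := even_sections_sub_normal Drho vrho nQ
  (fun y => Qc _ y (iter_rigid_comm omega i2)).
exists (i2.+1 + m); apply: stab_sub_of_vertices; first by case: nN.
move=> u z szu sz.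
have [h Gh hE] := tG i2.+1 (nseq i2.+1 true) u (size_nseq _ _) szu.
have [h' [Gh' _ _ hJ]] := Grig_section (nseq i2.+1 true) Gh.
rewrite hE size_nseq in Gh' hJ.
have [_ _ NJ] := nN; have [_ _ QJ] := nQ.
have GhV : Grig rho h'^-1 by case: (Grig_subgroup rho) => _ _; apply.
have := QJ _ _ (UQ _ (sm _ sz)) GhV.
rewrite iter_rigidE -at_vertex_nseq => /NJ/(_ Gh).
by rewrite hJ conjgKV.
Qed.

End Vertices.

(** * Finite index, and sequences that are eventually constant *)

Section FiniteIndex.

Lemma finite_image_factor (T : finType) (X Y : Type) (G : set X) (F : X -> T)
  (f : X -> Y) :
  (forall x y, G x -> G y -> F x = F y -> f x = f y) -> finite_set (f @` G).
Proof.
move=> fF; have [[x0 Gx0]|/forallNP G0] := pselect (exists x, G x); last first.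
  by rewrite (_ : G = set0) ?image_set0 //; apply/seteqP; split=> x // /G0.
pose h t := if pselect (exists x, G x /\ F x = t) is left e
            then f (projT1 (cid e)) else f x0.
apply: sub_finite_set (finite_image h (@finite_finset _ setT)).
move=> _ [x Gx <-]; exists (F x) => //; rewrite /h.
case: pselect => [e|]; last by case; exists x.
by case: cid => z /= [Gz Fz]; apply: fF.
Qed.

Variable gT : groupType.
Implicit Types G H N : set gT.

Lemma right_coset_refl H x : is_subgroup H -> right_coset H x x.
Proof. by case=> H1 _ _; exists 1; rewrite ?mul1g. Qed.

Lemma right_coset_eq H x y : is_subgroup H -> H (x * y^-1) ->
  right_coset H x = right_coset H y.
Proof.
move=> [H1 HM HV] Hxy; apply/seteqP; split=> _ [h Hh <-].
  by exists (h * (x * y^-1)); [apply: HM|rewrite !mulgA mulgVK].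
exists (h * (x * y^-1)^-1); first by apply: HM => //; apply: HV.
by rewrite invgM invgK !mulgA mulgVK.
Qed.

(** [G] is infinite, so it does not act faithfully on the finitely many cosets
   of [H]; the kernel of this action is the normal core of [H]. *)
Lemma nontrivial_core G H : is_subgroup G -> infinite_set G ->
  is_subgroup H -> finite_index G H ->
  exists N, [/\ is_normal G N, N `<=` H & N <> [set 1]].
Proof.
move=> sG infG sH; have [G1 GM GV] := sG; have [H1 HM HV] := sH.
move=> /finite_seqP[cs csE].
exists [set g | G g /\ forall x, G x -> H (g ^ x)]; split.
- split; first split.
  + by split=> // x _; rewrite conj1g.
  + move=> x y [Gx Nx] [Gy Ny]; split=> [|z Gz]; first exact: GM.
    by rewrite conjMg; apply: HM; auto.
  + by move=> x [Gx Nx]; split=> [|z Gz]; [apply: GV|rewrite conjVg; auto].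
  + by move=> x [].
  + move=> x g [Gx Nx] Gg; split=> [|z Gz]; first exact: subgroup_conj.
    by rewrite -conjgM; apply: Nx; apply: GM.
- by move=> x [_ /(_ 1 G1)]; rewrite conjg1.
- move=> N1; apply: infG; rewrite -(image_id G).
  pose F g := [set p : 'I_(size cs) * 'I_(size cs) | `[< exists x,
    [/\ G x, right_coset H x = nth set0 cs p.1 &
     right_coset H (x * g) = nth set0 cs p.2] >]]%SET.
  apply: (@finite_image_factor _ gT gT G F id) => g h Gg Gh eF.
  have cosetP x : G x ->
      exists i : 'I_(size cs), right_coset H x = nth set0 cs i.
    move=> Gx; have xcs : right_coset H x \in cs.
      by have : [set` cs] (right_coset H x) by rewrite -csE; exists x.
    move: (xcs); rewrite -index_mem => lt_i.
    by exists (Ordinal lt_i); rewrite nth_index.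
  suff [] : [set 1] (g * h^-1) by move/divg1_eq.
  rewrite -N1; split=> [|x Gx]; first by apply: GM => //; apply: GV.
  have Gy : G x^-1 by apply: GV.
  have [i iE] := cosetP _ Gy; have [j jE] := cosetP _ (GM _ _ Gy Gg).
  have : (i, j) \in F g by rewrite inE; apply/asboolP; exists x^-1.
  rewrite eF inE => /asboolP[z [Gz]]; rewrite -iE -jE => zx zg.
  have : right_coset H z x^-1 by rewrite zx; apply: right_coset_refl.
  have : right_coset H (z * h) (x^-1 * g).
    by rewrite zg; apply: right_coset_refl.
  case=> h2 Hh2 e2 [h1 Hh1 e1].
  have -> : (g * h^-1) ^ x = h2 * h1^-1.
    rewrite /conjg !mulgA -e2 -(invgK x) -e1 invgM !mulgA mulgK.
    by rewrite mulgK.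
  by apply: HM => //; apply: HV.
Qed.

Lemma finite_index1 G : finite_index G [set 1] -> finite_set G.
Proof.
move=> /(finite_image (xget 1)); apply: sub_finite_set => x Gx.
exists (right_coset [set 1] x); first by exists x.
have : right_coset [set 1] x x by exists 1; rewrite ?mul1g.
by case/(xgetI 1) => _ -> <-; rewrite mul1g.
Qed.

End FiniteIndex.

Section Branch.
Implicit Types (omega : nat -> 'I_3) (k l : 'I_3).

Lemma level_transitive_infinite G : level_transitive G -> infinite_set G.
Proof.
move=> tG /finite_seqP[s sE]; pose n := size s.
have : size (map val (enum {: n.-tuple bool})) <=
       size (map (fun g : treeAut => g (nseq n false)) s).
  apply: uniq_leq_size; first by rewrite (map_inj_uniq val_inj) enum_uniq.
  move=> _ /mapP[u _ ->].
  have [g Gg <-] := tG n (nseq n false) (val u) (size_nseq _ _) (size_tuple u).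
  by apply: map_f; have : [set` s] g by rewrite -sE.
rewrite size_map [X in _ <= X]size_map -cardE card_tuple card_bool.
by rewrite leqNgt ltn_expl.
Qed.

Lemma finite_index_stab omega N m : is_normal (Grig omega) N ->
  level_stab (Grig omega) m `<=` N -> finite_set (cosets (Grig omega) N).
Proof.
move=> [sN sNG _] sm; have [_ GM GV] := Grig_subgroup omega.
pose F (g : treeAut) :=
  [set p : m.-tuple bool * m.-tuple bool | g p.1 == p.2 :> word]%SET.
apply: (finite_image_factor (F := F)) => x y Gx Gy eF.
apply: right_coset_eq => //; apply: sm; split.
  by apply: GM => //; apply: GV.
move=> v /eqP szv.
have szx : size (x v) == m.
  by have [_ [_ -> _ _]] := Grig_section v Gx.
have : (Tuple szv, Tuple szx) \in F x by rewrite inE.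
by rewrite eF inE => /= /eqP <-; apply: aut_funK.
Qed.

(** For a constant sequence [G_omega] is dihedral: it is generated by [a] and
   an involution [y = (a, y)], and [r = a y] satisfies [r^2 = (r^-1, r)]. Every
   element [h] either commutes with [r] or inverts it. Let [h] be supported
   below a vertex of level 1. In the first case [h = 1], because [r] moves that
   vertex. In the second case [h] inverts [r^2] and acts trivially below the
   other vertex of level 1, so that [r = r^-1] and [(r^-1, r) = 1], which is
   absurd. *)
Lemma constant_rist omega b h : (forall i, omega i = omega 0) ->
  rist (Grig omega) [:: b] h -> h = 1.
Proof.
move=> co; have eo : shift omega = omega.
  by apply: funext => i; rewrite /shift co [RHS]co.
have [l Dl] := letter_neq (omega 0).
set y := gen_dir l omega; set r := 'a * y.
have yE : y = node 'a y by rewrite {1}/y gen_dirE dir_root_neq // eo.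
have d1 : gen_dir (omega 0) omega = 1.
  apply: treeAutP => v /=; elim: v => // -[] v IHv /=; first by rewrite eo IHv.
  by rewrite eqxx.
have rV : r^-1 = y * 'a by rewrite /r invgM gen_aV gen_dirV.
have rr : r * r = node r^-1 r.
  have -> : r * r = y ^ 'a * y by rewrite /r /conjg gen_aV !mulgA.
  by rewrite yE nodeJa nodeM rV.
case=> Gh hE.
have {Gh} [] : r ^ h = r \/ r ^ h = r^-1.
  move: h Gh {hE}; apply: (Grig_ind2 Dl).
  - split=> [|g g' [eg|eg] [eg'|eg']|g [eg|eg]]; rewrite ?conjg1; try by left.
    + by left; rewrite conjgM eg.
    + by right; rewrite conjgM eg.
    + by right; rewrite conjgM eg conjVg eg'.
    + by left; rewrite conjgM eg conjVg eg' invgK.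
    + by left; rewrite -{1}eg conjgK.
    + by right; rewrite -{1}(invgK r) -eg conjVg conjgK.
  - by right; rewrite rV /r /conjg gen_aV !mulgA gen_aK mul1g.
  - by left; rewrite d1 conjg1.
  - by right; rewrite rV /r /conjg gen_dirV -/y !mulgA -mulgA gen_dirK mulg1.
- move/conjg_fixP/commgP => hr.
  apply: treeAutP => -[|c v]; first exact: aut_root.
  have [cb|Dcb] := eqVneq c b; last by apply: hE; rewrite /= eq_sym (negPf Dcb).
  apply: (can_inj (@aut_funK r)).
  have : (r * h) (c :: v) = (h * r) (c :: v) by rewrite hr.
  move=> /= <-; apply: hE; rewrite -cb.
  by case: (c) => /=; rewrite ?prefix0s.
- move=> hr; exfalso.
  have eR : r * r * h = h * node r r^-1.
    by rewrite [LHS]conjgC conjMg hr -invgM rr nodeV invgK.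
  have e v : node r^-1 r (~~ b :: v) = node r r^-1 (~~ b :: v).
    have : (r * r * h) (~~ b :: v) = (h * node r r^-1) (~~ b :: v).
      by rewrite eR.
    rewrite rr /= => hv; rewrite -[RHS]/(node r r^-1 _) in hv *.
    by rewrite !hE in hv; [|case: (b)..].
  have rrV : r = r^-1.
    by apply: treeAutP => v; have := e v; case: (b) => /= -[].
  have : node r^-1 r = node 1 1 by rewrite -rr {1}rrV mulVg node1.
  case/node_inj=> _ r1.
  by have : r [:: true] = [:: true] by rewrite r1.
Qed.

Lemma eventually_constant_rist n omega u g :
  (forall i, n <= i -> omega i = omega n) ->
  size u = n.+1 -> rist (Grig omega) u g -> g = 1.
Proof.
elim: n omega u g => [|n IHn] omega [|b u] g // co [szu].
  by case: u szu => // _; apply: constant_rist => i; apply: co.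
case=> Gg gE.
have {}IHn h : Grig (shift omega) h ->
    (forall v, ~~ prefix u v -> h v = v) -> h = 1.
  by move=> Gh hE; apply: (IHn (shift omega) u) => // i le_ni; apply: co.
have [g0 [g1 [Gg0 Gg1 eg]]] := Grig_decomp Gg.
have {}eg : g = node g0 g1.
  case: eg => // eg; have : g [:: ~~ b] = [:: ~~ b] by apply: gE; case: (b).
  by rewrite eg; case: (b).
rewrite eg in gE *; suff [-> ->] : g0 = 1 /\ g1 = 1 by rewrite node1.
case: b gE => gE; split.
- by apply: treeAutP => v; have [] := gE (false :: v) isT.
- by apply: IHn => // v uv; have [] := gE (true :: v) uv.
- by apply: IHn => // v uv; have [] := gE (false :: v) uv.
- by apply: treeAutP => v; have [] := gE (true :: v) isT.
Qed.

(** Otherwise the rigid stabiliser of some level is trivial by the previous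
   lemma, and is of finite index in an infinite group. *)
Lemma branch_varying omega : branch (Grig omega) -> varying omega.
Proof.
case=> tG bG n; apply: contrapT => Nn.
have co i : n <= i -> omega i = omega n.
  move=> /subnKC<-; elim: (i - n) => [|j IHj]; first by rewrite addn0.
  rewrite addnS -IHj; apply/esym/eqP/negPn/negP => Dj.
  by apply: Nn; exists (n + j); rewrite ?leq_addr.
apply: (level_transitive_infinite tG).
have /(@finite_index1 treeAut) // : finite_index (Grig omega) [set 1].
have <- : level_rist (Grig omega) n.+1 = [set 1]; last exact: bG.
apply/seteqP; split=> [_ [g gr <-]|_ ->] /=.
  rewrite big1 // => u _.
  exact: eventually_constant_rist co (size_tuple u) (gr u).
exists (fun=> 1); last by rewrite big1.
by move=> u; split=> //; case: (Grig_subgroup omega).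
Qed.

End Branch.

Theorem theorem3p7 (omega : nat -> 'I_3)
    (omega_nonconstant : ~ exists x : 'I_3, forall i : nat, omega i = x)
    (branch_G : branch (Grigorchuk_group omega)) :
  congruence_subgroup_property (Grigorchuk_group omega) /\
  just_infinite (Grigorchuk_group omega).
Proof.
have vo := branch_varying branch_G; have [tG _] := branch_G.
have infG := level_transitive_infinite tG.
split; last split=> // N nN N1.
  move=> H sH _ fiH.
  have [N [nN sNH N1]] := nontrivial_core (Grig_subgroup omega) infG sH fiH.
  have [m sm] := normal_congruence vo tG nN N1.
  by exists m; apply: subset_trans sNH.
have [m sm] := normal_congruence vo tG nN N1.
exact: finite_index_stab nN sm.
Qed.
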